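(* Let $P$ be the spanning tree polytope of $K^n$. Consider a size-$r$ extension of $P$ and a corresponding randomized protocol of complexity $\lceil\lg r\rceil$ computing the slack matrix $S(P)$ in expectation, with normalized variance $\sigma^2$. Then $r=2^{\Omega(n(1-\sigma^2))}$ (as $n\to\infty$, with an absolute constant hidden in $\Omega$).
   Context: $\lg$ is the base-2 logarithm. $K^n$ is the complete graph on $[n]=\{1,\dots,n\}$. The spanning tree polytope of $K^n$ is the convex hull in $\mathbb{R}^{E(K^n)}$ of the characteristic vectors $\chi^{E(T)}$ of the edge sets of spanning trees $T$ of $K^n$. Its slack matrix $S(P)$ has one column per spanning tree $T$; its rows correspond to nonempty proper subsets $U\subsetneq[n]$, with entry $|U|-1-|E(T)\cap E[U]|$ (where $E[U]$ is the set of edges with both endpoints in $U$), i.e. the number of connected components of the subgraph $T[U]$ of $T$ induced by $U$ minus one, together with one row for each nonnegativity inequality $x_e\geqslant 0$, $e\in E(K^n)$, with entry $\chi^{E(T)}_e$. An extension of $P$ is a polyhedron $Q$ together with a linear map $\pi$ with $\pi(Q)=P$; its size is the number of facets of $Q$. Randomized protocols (with private random bits and nonnegative outputs). Let $X,Y$ be the finite sets indexing the rows and columns of a nonnegative matrix $S$. A randomized protocol is a rooted binary tree in which each node has a type, $X$ or $Y$. Each internal node $v$ of type $X$ carries functions $p_{0,v},p_{1,v}:X\to[0,1]$ with $p_{0,v}(x)+p_{1,v}(x)\leqslant 1$ for all $x$; each internal node $v$ of type $Y$ carries functions $q_{0,v},q_{1,v}:Y\to[0,1]$ with $q_{0,v}(y)+q_{1,v}(y)\leqslant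 1$ for all $y$. Each leaf $v$ of type $X$ carries a nonnegative vector $\Lambda_v\in\mathbb{R}_+^X$, and each leaf $v$ of type $Y$ a nonnegative vector $\Lambda_v\in\mathbb{R}_+^Y$. An execution on input $(x,y)\in X\times Y$ is a random path starting at the root: at an internal node $v$ of type $X$ it goes to the left child with probability $p_{0,v}(x)$, to the right child with probability $p_{1,v}(x)$, and stops at $v$ with the remaining probability; at an internal node of type $Y$ it does the same with $q_{0,v}(y),q_{1,v}(y)$ (choices at different nodes being independent). The value of an execution stopping at a leaf $v$ is $\Lambda_v(x)$ if $v$ has type $X$ and $\Lambda_v(y)$ if $v$ has type $Y$; the value of an execution stopping at an internal node is $0$. The protocol computes $S$ in expectation if for every $(x,y)$ the expectation of the value $\xi_{x,y}$ of an execution on $(x,y)$ equals $S(x,y)$. The complexity of a protocol is the height of its tree. The normalized variance of a protocol computing $S$ in expectation is $\sigma^2=\max\{\mathrm{Var}(\xi_{x,y}/S(x,y)) : S(x,y)\neq 0\}$. *)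

(* Defs.v *)
From HB Require Import structures.
From mathcomp Require Import all_boot all_order all_algebra.
From mathcomp Require Import all_classical all_reals all_analysis.

Set Implicit Arguments.
Unset Strict Implicit.
Unset Printing Implicit Defensive.

Import Order.TTheory GRing.Theory Num.Theory.

Local Open Scope classical_set_scope.
Local Open Scope ring_scope.
Local Open Scope card_scope.

Definition is_polyhedron (R : realType) (d : nat) (Q : set 'cV[R]_d) : Prop :=
  exists (m : nat) (A : 'M[R]_(m, d)) (b : 'cV[R]_m),
    Q = [set x | forall i, (A *m x) i 0 <= b i 0].

Definition is_face (R : realType) (d : nat) (Q F : set 'cV[R]_d) : Prop :=
  exists (a : 'rV[R]_d) (beta : R),
    (forall x, Q x -> (a *m x) 0 0 <= beta) /\
    F = [set x | Q x /\ (a *m x) 0 0 = beta].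

(* [F !=set0] matters only when [Q] is an affine subspace: it has no facet. *)
Definition facets (R : realType) (d : nat) (Q : set 'cV[R]_d) :
    set (set 'cV[R]_d) :=
  [set F | [/\ is_face Q F, F !=set0, F <> Q &
     forall G, is_face Q G -> G <> Q -> F `<=` G -> G = F]].

Definition is_extension (R : realType) (V : lmodType R) (d : nat)
    (Q : set 'cV[R]_d) (f : {linear 'cV[R]_d -> V}) (P : set V) : Prop :=
  is_polyhedron Q /\ f @` Q = P.

Definition has_size (R : realType) (d : nat) (Q : set 'cV[R]_d) (r : nat) : Prop :=
  facets Q #= `I_r.

Definition convex_hull (R : realType) (V : lmodType R) (A : set V) : set V :=
  smallest (@convex_set R V) A.

(* The vertex set {1, ..., n} is shifted to ['I_n] = {0, ..., n-1}. *)
Definition edge (n : nat) := {e : {set 'I_n} | #|e| == 2%N}.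

Definition adj (n : nat) (T : {set edge n}) : rel 'I_n :=
  [rel u v | [exists e in T, val e == [set u; v]%SET]].

(* A closed walk [u; v] along a single edge is a [ucycle] of size 2, hence the
   bound on the size of cycles. *)
Definition is_spanning_tree (n : nat) (T : {set edge n}) : Prop :=
  (forall u v, connect (adj T) u v) /\
  (forall c : seq 'I_n, ucycle (adj T) c -> (size c <= 2)%N).

Definition edge_space (R : realType) (n : nat) : lmodType R :=
  {ffun edge n -> R^o}.

Definition char_vec (R : realType) (n : nat) (T : {set edge n}) :
    edge_space R n :=
  [ffun e => (e \in T)%:R].

Definition spanning_tree_polytope (R : realType) (n : nat) :
    set (edge_space R n) :=
  convex_hull [set char_vec R T | T in @is_spanning_tree n].

Definition slack_row (n : nat) : finType :=
  ({U : {set 'I_n} | (U != finset.set0) && (U != [set: 'I_n]%SET)} + edge n)%type.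

Definition slack_col (n : nat) : finType :=
  {T : {set edge n} | `[< is_spanning_tree T >]}.

Definition slack (R : realType) (n : nat)
    (x : slack_row n) (T : slack_col n) : R :=
  match x with
  | inl U => #|val U|%:R - 1 - #|[set e in val T | val e \subset val U]%SET|%:R
  | inr e => char_vec R (val T) e
  end.

Inductive protocol (R X Y : Type) : Type :=
| LeafX (L : X -> R)
| LeafY (L : Y -> R)
| NodeX (p0 p1 : X -> R) (left right : protocol R X Y)
| NodeY (q0 q1 : Y -> R) (left right : protocol R X Y).

Fixpoint protocol_wf (R : realType) (X Y : Type) (t : protocol R X Y) : Prop :=
  match t with
  | LeafX L => forall x, 0 <= L x
  | LeafY L => forall y, 0 <= L y
  | NodeX p0 p1 l r =>
      [/\ forall x, [/\ 0 <= p0 x, 0 <= p1 x & p0 x + p1 x <= 1],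
          protocol_wf l & protocol_wf r]
  | NodeY q0 q1 l r =>
      [/\ forall y, [/\ 0 <= q0 y, 0 <= q1 y & q0 y + q1 y <= 1],
          protocol_wf l & protocol_wf r]
  end.

Fixpoint complexity (R X Y : Type) (t : protocol R X Y) : nat :=
  match t with
  | LeafX _ | LeafY _ => 0
  | NodeX _ _ l r | NodeY _ _ l r => (maxn (complexity l) (complexity r)).+1
  end.

(* The law of an execution on input (x, y): one pair (probability, value) for
   each node [v] of the tree, the probability being that of stopping at [v]. *)
Fixpoint executions (R : realType) (X Y : Type) (t : protocol R X Y)
    (x : X) (y : Y) : seq (R * R) :=
  let branch (p0 p1 : R) l r :=
    (1 - p0 - p1, 0) :: [seq (p0 * o.1, o.2) | o <- l] ++
                        [seq (p1 * o.1, o.2) | o <- r] in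
  match t with
  | LeafX L => [:: (1, L x)]
  | LeafY L => [:: (1, L y)]
  | NodeX p0 p1 l r =>
      branch (p0 x) (p1 x) (executions l x y) (executions r x y)
  | NodeY q0 q1 l r =>
      branch (q0 y) (q1 y) (executions l x y) (executions r x y)
  end.

(* The expectation of [g xi], for [xi] the value of an execution on (x, y). *)
Definition expect (R : realType) (X Y : Type) (t : protocol R X Y)
    (x : X) (y : Y) (g : R -> R) : R :=
  \sum_(o <- executions t x y) o.1 * g o.2.

Definition var (R : realType) (X Y : Type) (t : protocol R X Y)
    (x : X) (y : Y) (g : R -> R) : R :=
  expect t x y (fun xi => (g xi - expect t x y g) ^+ 2).

Definition computes_in_expectation (R : realType) (X Y : Type)
    (t : protocol R X Y) (S : X -> Y -> R) : Prop :=
  forall x y, expect t x y id = S x y.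

(* Variances of a well-formed protocol are nonnegative, so the default value 0
   only matters when [S] is identically zero. *)
Definition normalized_variance (R : realType) (X Y : finType)
    (t : protocol R X Y) (S : X -> Y -> R) : R :=
  \big[Num.max/0]_(xy : X * Y | S xy.1 xy.2 != 0)
    var t xy.1 xy.2 (fun xi => xi / S xy.1 xy.2).

(* Main.v *)
(** Let [Z(x, y)] be the probability that an execution on [(x, y)] has value [0].
    It is a sum of nonnegative rank-one matrices with entries in [[0, 1]], one
    for each node of the tree, hence of at most [2^(k+1)] of them at height [k].
    It equals 1 where the slack vanishes and, by Chebyshev's inequality, it is
    at most [sigma^2] elsewhere.  Take a power [Z^m] with [m] of order
    [1/(1 - sigma^2)]: it remains 1 on zero slacks, and becomes at most a small
    constant on nonzero slacks.

    The slack matrix contains set disjointness: let [U_A] consist of a hub and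
    of the leaves in [A], and let [T_B] be the double star in which the leaves
    in [B] hang from a second hub, outside [U_A].  The slack of [(U_A, T_B)] is
    [|A ∩ B|].  So [Z^m] is 1 on disjoint pairs and small on intersecting ones,
    and Razborov's corruption bound shows that exponentially many rank-one terms
    are needed for that: [2^((k+1)m) >= 2^(Omega(n))]. *)

Require Import Defs.
From mathcomp Require Import all_boot all_order all_algebra.
From mathcomp Require Import ring lra zify.

Set Implicit Arguments.
Unset Strict Implicit.
Unset Printing Implicit Defensive.

Import Order.TTheory GRing.Theory Num.Theory.

Local Open Scope ring_scope.

(** * Corruption bound for set disjointness *)

Lemma bernoulli_ler (R : realDomainType) (m : nat) (x : R) :
  -1 <= x -> 1 + m%:R * x <= (1 + x) ^+ m.
Proof.
move=> x1; elim: m => [|m IH]; first by rewrite mul0r addr0.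
have x1_ge0 : 0 <= 1 + x by lra.
rewrite exprSr; apply: le_trans (ler_wpM2r x1_ge0 IH).
have : 0 <= m%:R * (x * x) by rewrite mulr_ge0 // -expr2 sqr_ge0.
by rewrite -natr1; nra.
Qed.

Section Corruption.
Variables (R : realFieldType) (T : finType).
Implicit Types (f g : {set T} -> R) (X Z : {set T}) (i : T).

(** * Averages over a uniformly random subset *)

Definition mean f : R := (\sum_X f X) / 2 ^+ #|T|.

Lemma pow2_gt0 : (0 : R) < 2 ^+ #|T|. Proof. by rewrite exprn_gt0. Qed.

Lemma eq_mean f g : f =1 g -> mean f = mean g.
Proof. by move=> fg; congr (_ / _); apply: eq_bigr => X _; apply: fg. Qed.

Lemma ler_mean f g : (forall X, f X <= g X) -> mean f <= mean g.
Proof.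
by move=> fg; rewrite ler_pM2r ?invr_gt0 ?pow2_gt0 //; apply: ler_sum.
Qed.

Lemma meanD f g : mean (fun X => f X + g X) = mean f + mean g.
Proof. by rewrite /mean big_split mulrDl. Qed.

Lemma meanZ c f : mean (fun X => c * f X) = c * mean f.
Proof. by rewrite /mean -mulr_sumr mulrA. Qed.

Lemma mean_cst c : mean (fun=> c) = c.
Proof.
have card : #|{: {set T}}| = (2 ^ #|T|)%N.
  by rewrite -[LHS]cardsT -powersetT card_powerset cardsT.
by rewrite /mean sumr_const card -[c *+ _]mulr_natr natrX mulfK // gt_eqF ?pow2_gt0.
Qed.

Lemma mean_sum (I : Type) (s : seq I) (P : pred I) (F : I -> {set T} -> R) :
  mean (fun X => \sum_(v <- s | P v) F v X) = \sum_(v <- s | P v) mean (F v).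
Proof. by rewrite /mean exchange_big mulr_suml. Qed.

Lemma mean_ge0 f : (forall X, 0 <= f X) -> 0 <= mean f.
Proof. by move=> f0; rewrite -(mean_cst 0); apply: ler_mean. Qed.

Lemma mean_le1 f : (forall X, f X <= 1) -> mean f <= 1.
Proof. by move=> f1; rewrite -(mean_cst 1); apply: ler_mean. Qed.

(** Symmetric difference with [[set i]]: an involution, so it preserves averages. *)
Definition toggle i X := if i \in X then X :\ i else i |: X.

Lemma in_toggle i j X : (j \in toggle i X) = (j \in X) (+) (j == i).
Proof.
rewrite /toggle; case: ifP => iX; rewrite !inE; case: eqP => [->|] //=.
- by rewrite iX.
- by rewrite addbF.
- by rewrite iX.
- by rewrite addbF.
Qed.

Lemma toggleK i : involutive (toggle i).
Proof. by move=> X; apply/setP => j; rewrite !in_toggle -addbA addbb addbF. Qed.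

Lemma toggleC i X : ~: toggle i X = toggle i (~: X).
Proof. by apply/setP => j; rewrite !(inE, in_toggle) addNb. Qed.

Lemma mean_toggle i f : mean (fun X => f (toggle i X)) = mean f.
Proof.
congr (_ / _); rewrite [RHS](reindex_inj (inv_inj (toggleK i))).
exact: eq_bigr.
Qed.

Lemma mean_split i f :
  mean f = mean (fun X => f (i |: X) + f (X :\ i)) / 2.
Proof.
rewrite [in RHS](@eq_mean _ (fun X => f X + f (toggle i X))); last first.
  move=> X; rewrite /toggle; case: ifP => iX.
    by have /setUidPr-> : [set i] \subset X by rewrite sub1set.
  by rewrite addrC (setDidPl _) // disjoint_sym disjoints1 iX.
by rewrite meanD mean_toggle; lra.
Qed.

(** * Averages over the subcube of subsets of [Z] *)

Definition slice f Z := mean (fun X => f (X :&: Z)).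
Definition slice_at (c : bool) f Z i :=
  mean (fun X => f (if c then i |: X :&: Z else X :&: Z :\ i)).

Lemma slice_ge0 f Z : (forall X, 0 <= f X) -> 0 <= slice f Z.
Proof. by move=> f0; apply: mean_ge0. Qed.

Lemma slice_at_ge0 c f Z i : (forall X, 0 <= f X) -> 0 <= slice_at c f Z i.
Proof. by move=> f0; apply: mean_ge0. Qed.

Lemma slice_in f Z i : i \in Z ->
  slice f Z = (slice_at true f Z i + slice_at false f Z i) / 2.
Proof.
move=> iZ; rewrite /slice (mean_split i) -meanD; congr (_ / _).
apply: eq_mean => X; congr (f _ + f _); apply/setP => j; rewrite !inE.
  by case: eqP => // ->.
by rewrite andbA.
Qed.

Lemma slice_notin f Z i : i \notin Z -> slice f Z = slice_at false f Z i.
Proof.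
move=> iZ; apply: eq_mean => X; congr f; apply/setP => j; rewrite !inE.
by case: eqP => // ->; rewrite (negPf iZ) andbF.
Qed.

(** Forcing the coordinate [i] makes its membership in [Z] irrelevant; this is what lets [Z] and
    [toggle i Z] be compared. *)
Lemma slice_at_toggle c f Z i : slice_at c f (toggle i Z) i = slice_at c f Z i.
Proof.
apply: eq_mean => X; congr f.
by case: c; apply/setP => j; rewrite !(inE, in_toggle); case: eqP; rewrite ?addbF.
Qed.

Lemma mean_slice_at f Z i c : i \in Z ->
  mean (fun X => ((i \in X) == c)%:R * f (X :&: Z)) = slice_at c f Z i / 2.
Proof.
move=> iZ; rewrite (mean_split i); congr (_ / _); apply: eq_mean => X.
rewrite !inE eqxx /=; case: c; rewrite /= ?mul0r ?mul1r ?addr0 ?add0r; congr f;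
  apply/setP => j; rewrite !inE.
  by case: eqP => // ->.
by rewrite andbA.
Qed.

(* A coordinate [i] free in the subcube of the subsets of [Z] is bad when the
   density proportional to [f] on that subcube is strongly biased on [i]. *)
Definition bad f Z : {set T} :=
  [set i in Z | [exists c : bool,
     8 * slice_at c f Z i < slice_at true f Z i + slice_at false f Z i]].

(** The count is binomial with parameters [#|I|] and 1/2; its generating function factors over the
    coordinates. *)
Lemma mean_biased_count (q : R) (w : T -> bool) (I : {set T}) :
  mean (fun X => q ^+ #|[set i in I | (i \in X) == w i]|) =
  ((1 + q) / 2) ^+ #|I|.
Proof.
pose x (b : bool) i : R := if (i \in I) && (b == w i) then q else 1.
have cntE X : q ^+ #|[set i in I | (i \in X) == w i]| =
    \prod_i (if i \in X then x true i else x false i).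
  rewrite -sum1_card expr_sum (eq_bigr (fun=> q)) => [|? _]; last exact: expr1.
  rewrite big_mkcond; apply: eq_bigr => i _; rewrite !inE /x.
  by case: (i \in X).
rewrite (eq_mean cntE) /mean -(bigA_distr _ _ (x true) (x false)).
rewrite -prodr_const -[2 ^+ _]prodr_const -prodf_div [RHS]big_mkcond.
apply: eq_bigr => i _; rewrite /x; case: (i \in I) => /=.
  by case: (w i); rewrite /= 1?[q + 1]addrC.
by lra.
Qed.

(* Under the density proportional to [f], the number of bad coordinates that
   take their rare value is at most 1/8 of all bad coordinates on average,
   hence at most 1/4 with probability 1/2; a Chernoff bound shows that this
   event is exponentially unlikely for a uniform set. *)
Lemma slice_le_bad f Z : (forall X, 0 <= f X <= 1) -> (0 < #|bad f Z|)%N ->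
  slice f Z <= 2 * (8 / 9) ^+ #|bad f Z|.
Proof.
move=> f01; set I := bad f Z => I_gt0; set k := #|I| in I_gt0 *.
(* For a bad [i], [w i] is its rare value. *)
pose w i := [exists c : bool, c &&
  (8 * slice_at c f Z i < slice_at true f Z i + slice_at false f Z i)].
have Iw i : i \in I -> (i \in Z) /\
    8 * slice_at (w i) f Z i <= slice_at true f Z i + slice_at false f Z i.
  rewrite inE => /andP[-> /existsP[c Hc]]; split => //.
  case wi: (w i).
    by case/existsP: wi => -[] //= /ltW.
  case: c Hc => [Hc|/ltW//]; move/negbT/existsPn/(_ true): wi.
  by rewrite /= Hc.
pose cnt X := #|[set i in I | (i \in X) == w i]|.
have k_gt0 : 0 < k%:R :> R by rewrite ltr0n.
have q_gt0 : 0 < (3 / 4 : R) by lra.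
(* If [k <= 4 * cnt X], the first term alone suffices, as in Markov's inequality. Otherwise [f] is
   at most 1 and the second term is 3/4 to a negative power. *)
have pw X : f (X :&: Z) <= (4 / k%:R) * ((cnt X)%:R * f (X :&: Z))
    + ((3/4) ^- k) * ((3/4) ^+ 4) ^+ cnt X.
  have /andP[f0 f1] := f01 (X :&: Z).
  have [kc|ck] := leqP k (4 * cnt X).
    apply: (@le_trans _ _ ((4 / k%:R) * ((cnt X)%:R * f (X :&: Z)))).
      rewrite mulrA ler_peMl // mulrAC ler_pdivlMr // mul1r -natrM.
      by rewrite ler_nat.
    by rewrite lerDl mulr_ge0 // ?invr_ge0 !exprn_ge0 //; lra.
  apply: (le_trans f1); apply: ler_wpDl.
    by rewrite !mulr_ge0 // ?invr_ge0.
  rewrite -exprM mulrC ler_pdivlMr ?exprn_gt0 // mul1r.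
  by rewrite ler_wiXn2l ?(ltnW ck) //; lra.
have meancnt : mean (fun X => (cnt X)%:R * f (X :&: Z)) <= k%:R * slice f Z / 8.
  have cntE X : (cnt X)%:R * f (X :&: Z) =
      \sum_(i in I) ((i \in X) == w i)%:R * f (X :&: Z).
    rewrite -mulr_suml -natr_sum; congr (_%:R * _).
    rewrite /cnt -sum1_card [RHS]big_mkcond [LHS]big_mkcond; apply: eq_bigr => i _.
    by rewrite inE; case: (i \in I) => //=; case: (_ == _).
  rewrite (eq_mean cntE) mean_sum.
  have -> : k%:R * slice f Z / 8 = \sum_(i in I) slice f Z / 8.
    by rewrite sumr_const -[RHS]mulr_natl mulrA.
  apply: ler_sum => i iI; have [iZ Hi] := Iw _ iI.
  rewrite mean_slice_at // (slice_in _ iZ); lra.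
have := ler_mean pw; rewrite meanD !meanZ mean_biased_count -/(slice f Z) -/k.
set t := _ ^- _ * _ => H.
(* The base is [(1 + (3/4)^4) / 2] divided by 3/4, that is 337/384. *)
have tE : t <= (8 / 9) ^+ k.
  rewrite /t mulrC -expr_div_n lerXn2r ?nnegrE //; try lra.
have : 4 / k%:R * mean (fun X => (cnt X)%:R * f (X :&: Z)) <= slice f Z / 2.
  have -> : slice f Z / 2 = 4 / k%:R * (k%:R * slice f Z / 8).
    by field; rewrite gt_eqF.
  by rewrite ler_wpM2l // divr_ge0 // ltW.
move: H tE; move: (_ ^+ k) (_ / _ * _) (slice f Z) t; clear=> e u s t; lra.
Qed.

(** * Moving one coordinate between [Z] and its complement *)

Definition pair_weight f g Z := slice f Z * slice g (~: Z).

Lemma pair_weightC f g Z : pair_weight g f (~: Z) = pair_weight f g Z.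
Proof. by rewrite /pair_weight setCK mulrC. Qed.

(** An indicator: [i] lies in only one of [Z] and [~: Z], so at most one summand is nonzero. *)
Definition is_bad f g Z i : R := (i \in bad f Z)%:R + (i \in bad g (~: Z))%:R.

Definition crossing f g Z i := slice_at true f Z i * slice_at true g (~: Z) i.

Lemma pair_weight_ge0 f g Z : (forall X, 0 <= f X) -> (forall X, 0 <= g X) ->
  0 <= pair_weight f g Z.
Proof. by move=> f0 g0; rewrite mulr_ge0 ?slice_ge0. Qed.

Lemma notin_bad f Z i c : i \in Z -> i \notin bad f Z ->
  slice_at true f Z i + slice_at false f Z i <= 8 * slice_at c f Z i.
Proof. by move=> iZ; rewrite inE iZ /= => /existsPn /(_ c); rewrite -leNgt. Qed.

Lemma is_badC f g Z i : is_bad g f (~: Z) i = is_bad f g Z i.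
Proof. by rewrite /is_bad setCK addrC. Qed.

(** Let [f1, f0, g1, g0] be the conditional averages at [i]. The weight is [(f1 + f0) * g0 / 2] at
    [Z] and [f0 * (g1 + g0) / 2] at [toggle i Z]. If [i] is bad for [f], the first term suffices.
    Otherwise [f1 + f0 <= 8 * f0], so the second does if [i] is bad for [g] after the toggle. If
    neither is bad, [f1 + f0 <= 8 * f1] and [g0 <= 7 * g1], whence the constant 28 = 8 * 7 / 2. *)
Lemma pair_weight_step_in f g Z i :
  (forall X, 0 <= f X) -> (forall X, 0 <= g X) -> i \in Z ->
  pair_weight f g Z <= pair_weight f g Z * is_bad f g Z i
    + 8 * (pair_weight f g (toggle i Z) * is_bad f g (toggle i Z) i)
    + 28 * crossing f g Z i.
Proof.
move=> f_ge0 g_ge0 iZ; have iZc : i \notin ~: Z by rewrite inE iZ.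
have iZt : i \notin toggle i Z by rewrite in_toggle iZ eqxx.
have iZtc : i \in ~: toggle i Z by rewrite inE iZt.
have Nbad h (Y : {set T}) : i \notin Y -> (i \in bad h Y) = false.
  by move=> iY; rewrite inE (negPf iY).
rewrite /is_bad !(Nbad _ _ iZc) !(Nbad _ _ iZt) addr0 add0r /crossing.
have bg c : i \notin bad g (~: toggle i Z) ->
    slice_at true g (~: Z) i + slice_at false g (~: Z) i <=
    8 * slice_at c g (~: Z) i.
  by move=> /(notin_bad c iZtc); rewrite toggleC !slice_at_toggle.
have bf c := @notin_bad f _ i c iZ.
rewrite /pair_weight (slice_in _ iZ) (slice_notin _ iZc) (slice_notin _ iZt).
rewrite (slice_in _ iZtc) toggleC !slice_at_toggle in bg *.
have := slice_at_ge0 true Z i f_ge0; have := slice_at_ge0 false Z i f_ge0.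
have := slice_at_ge0 true (~: Z) i g_ge0.
have := slice_at_ge0 false (~: Z) i g_ge0.
case: (boolP (i \in bad f Z)) bf => [_ _|_ /(_ _ isT) bf] /=;
  case: (boolP (i \in bad g _)) bg => [_ _|_ /(_ _ isT) bg] /=.
- move: (slice_at true f Z i) (slice_at false f Z i) (slice_at true g _ i)
    (slice_at false g _ i) => f1 f0 g1 g0 *; nra.
- move: (slice_at true f Z i) (slice_at false f Z i) (slice_at true g _ i)
    (slice_at false g _ i) => f1 f0 g1 g0 *; nra.
- move: (bf false).
  move: (slice_at true f Z i) (slice_at false f Z i) (slice_at true g _ i)
    (slice_at false g _ i) => f1 f0 g1 g0 *; nra.
- move: (bf true) (bg true).
  move: (slice_at true f Z i) (slice_at false f Z i) (slice_at true g _ i)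
    (slice_at false g _ i) => f1 f0 g1 g0 Hf Hg *.
  have : (f1 + f0) * g0 <= (8 * f1) * (7 * g1) by rewrite ler_pM //; lra.
  lra.
Qed.

(** When [i] is outside [Z], exchange [f] with [g] and [Z] with its complement. *)
Lemma pair_weight_step f g Z i :
  (forall X, 0 <= f X) -> (forall X, 0 <= g X) ->
  pair_weight f g Z <= pair_weight f g Z * is_bad f g Z i
    + 8 * (pair_weight f g (toggle i Z) * is_bad f g (toggle i Z) i)
    + 28 * crossing f g Z i.
Proof.
move=> f0 g0; have [iZ|iZ] := boolP (i \in Z); first exact: pair_weight_step_in.
have iZc : i \in ~: Z by rewrite inE.
have := pair_weight_step_in g0 f0 iZc.
rewrite -!toggleC !pair_weightC !is_badC /crossing setCK.
by rewrite [slice_at _ g _ _ * _]mulrC.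
Qed.

(* The constant is such that [decay ^+ 36 >= 8 / 9]; there 1/36 is the fraction
   of bad coordinates that the corruption bound tolerates. *)
Definition decay : R := 399 / 400.

Lemma decay_gt0 : 0 < decay. Proof. by rewrite /decay; lra. Qed.
Lemma decay_lt1 : decay < 1. Proof. by rewrite /decay; lra. Qed.

Lemma decay36 : 8 / 9 <= decay ^+ 36.
Proof.
have dN1 : -1 <= decay - 1 by rewrite /decay; lra.
have := bernoulli_ler 36 dN1; rewrite [1 + (_ - _)]addrC subrK.
by move: (_ ^+ 36) => u; rewrite /decay; lra.
Qed.

(** Either at most 1/36 of the coordinates are bad, or there are so many that [slice_le_bad] makes
    the slice itself at most [2 * decay ^+ #|T|]. *)
Lemma slice_bad_le f Z : (forall X, 0 <= f X <= 1) -> (0 < #|T|)%N ->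
  slice f Z * #|bad f Z|%:R <= #|T|%:R * (slice f Z / 36 + 2 * decay ^+ #|T|).
Proof.
move=> f01 T_gt0; have F0 : 0 <= slice f Z by apply: slice_ge0 => X; case/andP: (f01 X).
have d0 := ltW decay_gt0; have d1 := ltW decay_lt1; set k := #|bad f Z|.
have dn_ge0 : 0 <= decay ^+ #|T| by rewrite exprn_ge0.
have [kT|Tk] := leqP (36 * k) #|T|.
  apply: (@le_trans _ _ (slice f Z * (#|T|%:R / 36))).
    rewrite ler_wpM2l // ler_pdivlMr // mulrC -natrM ler_nat //.
  rewrite [_%:R * (_ + _)]mulrDr mulrCA lerDl.
  by rewrite !mulr_ge0.
have k_gt0 : (0 < k)%N by case: (posnP k) Tk => // ->; rewrite muln0.
have := slice_le_bad f01 k_gt0; rewrite -/k => Fle.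
have kn : k%:R <= #|T|%:R :> R by rewrite ler_nat max_card.
have dk : (8 / 9) ^+ k <= decay ^+ #|T|.
  apply: (@le_trans _ _ (decay ^+ (36 * k))); last by apply: ler_wiXn2l (ltnW Tk).
  rewrite exprM; apply: lerXn2r decay36; rewrite nnegrE ?exprn_ge0 //.
  by rewrite divr_ge0.
apply: (@le_trans _ _ (#|T|%:R * slice f Z)); first by rewrite mulrC ler_wpM2r.
rewrite ler_wpM2l //; move: Fle dk F0.
by move: (slice f Z) (_ ^+ k) (decay ^+ _); clear=> F u e *; lra.
Qed.

(* Razborov's corruption bound. For a random set [Z] and independent random
   sets [X] and [Y], the left side is the measure of [f ⊗ g] on the disjoint
   pairs [(X ∩ Z, Y \ Z)], and [crossing] is its measure on the pairs
   [(i ∪ (X ∩ Z), i ∪ (Y \ Z))], which meet exactly in [i]. *)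
Lemma corruption f g :
  (forall X, 0 <= f X <= 1) -> (forall X, 0 <= g X <= 1) -> (0 < #|T|)%N ->
  mean (pair_weight f g) <=
    72 * decay ^+ #|T| + 56 * ((\sum_i mean (fun Z => crossing f g Z i)) / #|T|%:R).
Proof.
move=> f01 g01 T_gt0.
have f0 X : 0 <= f X by case/andP: (f01 X).
have g0 X : 0 <= g X by case/andP: (g01 X).
have n_gt0 : 0 < #|T|%:R :> R by rewrite ltr0n.
set C := \sum_i mean (fun Z => crossing f g Z i).
set h := pair_weight f g; set n : R := #|T|%:R in n_gt0 *.
set e := decay ^+ #|T|.
have h0 Z : 0 <= h Z by apply: pair_weight_ge0.
(* Averaged over [Z], the toggled term equals the untoggled one: 9 = 1 + 8. *)
have step i : mean h <= 9 * mean (fun Z => h Z * is_bad f g Z i)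
    + 28 * mean (fun Z => crossing f g Z i).
  have := ler_mean (fun Z => pair_weight_step Z i f0 g0).
  rewrite !meanD !meanZ (mean_toggle i (fun Z => pair_weight f g Z * is_bad f g Z i)).
  by rewrite -/h; lra.
have : n * mean h <= \sum_i (9 * mean (fun Z => h Z * is_bad f g Z i)
    + 28 * mean (fun Z => crossing f g Z i)).
  rewrite /n cardT -cardE mulr_natl -sumr_const; exact: ler_sum.
rewrite big_split -!mulr_sumr -mean_sum /= -/C => H1.
have badE Z : \sum_i h Z * is_bad f g Z i =
    slice f Z * #|bad f Z|%:R * slice g (~: Z)
    + slice g (~: Z) * #|bad g (~: Z)|%:R * slice f Z.
  rewrite -mulr_sumr big_split -!natr_sum /=.
  have cntE (A : {set T}) : (\sum_i (i \in A) = #|A|)%N.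
    by rewrite -sum1_card [RHS]big_mkcond; apply: eq_bigr => i _; case: (i \in A).
  by rewrite !cntE /h /pair_weight; ring.
(* The bad coordinates of [f] and those of [g] each contribute a fraction 1/36 of the weight. *)
have : mean (fun Z => \sum_i h Z * is_bad f g Z i)
    <= mean (fun Z => n / 18 * h Z + n * (4 * e)).
  apply: ler_mean => Z; rewrite badE.
  have Hf := slice_bad_le Z f01 T_gt0; have Hg := slice_bad_le (~: Z) g01 T_gt0.
  have F0 := slice_ge0 Z f0; have G0 := slice_ge0 (~: Z) g0.
  have F1 : slice f Z <= 1 by apply: mean_le1 => X; case/andP: (f01 (X :&: Z)).
  have G1 : slice g (~: Z) <= 1 by apply: mean_le1 => X; case/andP: (g01 (X :&: ~: Z)).
  have ne0 : 0 <= n * e.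
    by rewrite mulr_ge0 ?ltW // exprn_gt0 ?decay_gt0.
  have := ler_wpM2r G0 Hf; have := ler_wpM2r F0 Hg; rewrite -/n -/e /h /pair_weight.
  have := ler_wpM2l ne0 F1; have := ler_wpM2l ne0 G1.
  lra.
rewrite meanD meanZ mean_cst => H2.
have -> : C / n = n^-1 * C by rewrite mulrC.
rewrite -(ler_pM2l n_gt0) mulrDr [n * (56 * _)]mulrCA mulVKf ?gt_eqF //.
(* The fraction 9/18 = 1/2 of the weight is absorbed on the left; doubling what remains turns 36 and
   28 into 72 and 56. *)
move: H1 H2; move: (mean _) (mean _) => a b; lra.
Qed.

(** Sum the corruption bound over the rank-one terms. The disjoint pairs have total measure 1, while
    the crossing terms contribute at most 56/112 = 1/2, so the exponentially small errors must make
    up the other half. *)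
Lemma disjointness_rank_lower_bound (I : finType) (a b : I -> {set T} -> R) :
  (0 < #|T|)%N ->
  (forall v X, 0 <= a v X <= 1) -> (forall v X, 0 <= b v X <= 1) ->
  (forall A B : {set T}, [disjoint A & B] -> \sum_v a v A * b v B = 1) ->
  (forall A B : {set T}, ~~ [disjoint A & B] -> \sum_v a v A * b v B <= 112^-1) ->
  1 <= 144 * (#|I|%:R * decay ^+ #|T|).
Proof.
move=> T_gt0 a01 b01 Hdisj Hint.
have n_gt0 : 0 < #|T|%:R :> R by rewrite ltr0n.
have sum_mean2 (A B : {set T} -> {set T}) :
    \sum_v mean (fun X => a v (A X)) * mean (fun Y => b v (B Y)) =
    mean (fun X => mean (fun Y => \sum_v a v (A X) * b v (B Y))).
  transitivity (mean (fun X => \sum_v a v (A X) * mean (fun Y => b v (B Y)))).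
    rewrite mean_sum; apply: eq_bigr => v _; rewrite mulrC -meanZ.
    by apply: eq_mean => X; rewrite mulrC.
  apply: eq_mean => X; rewrite mean_sum; apply: eq_bigr => v _.
  by rewrite meanZ.
have D1 : \sum_v mean (pair_weight (a v) (b v)) = 1.
  rewrite -mean_sum -[RHS]mean_cst; apply: eq_mean => Z.
  rewrite /pair_weight sum_mean2 -[RHS]mean_cst; apply: eq_mean => X.
  rewrite -[RHS]mean_cst; apply: eq_mean => Y; apply: Hdisj.
  by apply/pred0P => j /=; rewrite !inE; case: (j \in Z); rewrite ?andbF.
have U1 : \sum_v \sum_i mean (fun Z => crossing (a v) (b v) Z i) <= #|T|%:R / 112.
  rewrite exchange_big /= mulr_natl -sumr_const; apply: ler_sum => i _.
  rewrite -mean_sum -[leRHS]mean_cst; apply: ler_mean => Z.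
  rewrite /crossing sum_mean2 -[leRHS]mean_cst; apply: ler_mean => X.
  rewrite -[leRHS]mean_cst; apply: ler_mean => Y; apply: Hint.
  by apply/pred0Pn; exists i; rewrite /= !inE eqxx.
have : 1 <= \sum_v (72 * decay ^+ #|T| +
    56 * ((\sum_i mean (fun Z => crossing (a v) (b v) Z i)) / #|T|%:R)).
  by rewrite -[leLHS]D1; apply: ler_sum => v _; apply: corruption.
rewrite big_split /= sumr_const -mulr_sumr -mulr_suml -[_ *+ #|_|]mulr_natl.
have : (\sum_v \sum_i mean (fun Z => crossing (a v) (b v) Z i)) / #|T|%:R <= 112^-1.
  by rewrite ler_pdivrMr // mulrC.
move: (_ / _) (decay ^+ _) => u e; lra.
Qed.

End Corruption.

From mathcomp Require Import all_classical all_reals all_analysis.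

(** * Zero probability of a protocol *)

Section RankOneSums.
Variables (R : realFieldType) (X Y : Type).
Implicit Types (M : X -> Y -> R) (N : nat).

Definition rank_one_sum N M : Prop :=
  exists (I : finType) (a : I -> X -> R) (b : I -> Y -> R),
    [/\ (#|I| <= N)%N, forall v x, 0 <= a v x <= 1, forall v y, 0 <= b v y <= 1
      & forall x y, M x y = \sum_v a v x * b v y].

Lemma mulr_itv01 (u v : R) : 0 <= u <= 1 -> 0 <= v <= 1 -> 0 <= u * v <= 1.
Proof. by case/andP=> u0 u1 /andP[v0 v1]; rewrite mulr_ge0 // mulr_ile1. Qed.

Lemma rank_one_sum_leq N N' M :
  (N <= N')%N -> rank_one_sum N M -> rank_one_sum N' M.
Proof. by move=> NN' [I [a [b [IN *]]]]; exists I, a, b; split=> //; apply: leq_trans NN'. Qed.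

Lemma eq_rank_one_sum N M M' :
  (forall x y, M x y = M' x y) -> rank_one_sum N M -> rank_one_sum N M'.
Proof. by move=> MM' [I [a [b [? ? ? ME]]]]; exists I, a, b; split=> // x y; rewrite -MM'. Qed.

Lemma rank_one_sum1 (a : X -> R) (b : Y -> R) :
  (forall x, 0 <= a x <= 1) -> (forall y, 0 <= b y <= 1) ->
  rank_one_sum 1 (fun x y => a x * b y).
Proof.
move=> a01 b01; exists unit, (fun=> a), (fun=> b); split=> // [|x y].
  by rewrite card_unit.
by rewrite (big_pred1 tt) // => -[].
Qed.

Lemma rank_one_sumD N N' M M' : rank_one_sum N M -> rank_one_sum N' M' ->
  rank_one_sum (N + N') (fun x y => M x y + M' x y).
Proof.
move=> [I [a [b [IN a01 b01 ME]]]] [I' [a' [b' [IN' a01' b01' ME']]]].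
exists (I + I')%type, (fun v => match v with inl i => a i | inr j => a' j end),
  (fun v => match v with inl i => b i | inr j => b' j end).
split=> [|[]|[]|x y] //; first by rewrite card_sum leq_add.
by rewrite big_sumType ME ME'.
Qed.

(** An entrywise product of rank-one matrices has rank one, so the terms of the product are indexed
    by pairs. *)
Lemma rank_one_sumM N N' M M' : rank_one_sum N M -> rank_one_sum N' M' ->
  rank_one_sum (N * N') (fun x y => M x y * M' x y).
Proof.
move=> [I [a [b [IN a01 b01 ME]]]] [I' [a' [b' [IN' a01' b01' ME']]]].
exists (I * I')%type, (fun v x => a v.1 x * a' v.2 x), (fun v y => b v.1 y * b' v.2 y).
split=> [|v x|v y|x y]; rewrite ?mulr_itv01 //; first by rewrite card_prod leq_mul.
rewrite ME ME' big_distrlr pair_bigA /=; apply: eq_bigr => v _.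
by rewrite mulrACA.
Qed.

Lemma rank_one_sumX N M m : rank_one_sum N M ->
  rank_one_sum (N ^ m) (fun x y => M x y ^+ m).
Proof.
move=> rM; elim: m => [|m IH].
  apply: (@eq_rank_one_sum _ (fun _ _ => 1 * 1)) => [x y|]; first by rewrite mulr1.
  by apply: rank_one_sum1 => ?; rewrite ler01 lexx.
rewrite expnS; apply: eq_rank_one_sum (rank_one_sumM rM IH) => x y.
by rewrite exprS.
Qed.

End RankOneSums.

(** * Expectations over executions *)

Section Protocols.
Variables (R : realType) (X Y : Type).
Implicit Types (t : protocol R X Y) (g h : R -> R) (x : X) (y : Y).

Lemma expect_branch (p0 p1 : R) (l r : seq (R * R)) g :
  \sum_(o <- (1 - p0 - p1, 0) :: [seq (p0 * o.1, o.2) | o <- l] ++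
             [seq (p1 * o.1, o.2) | o <- r]) o.1 * g o.2 =
  (1 - p0 - p1) * g 0 + (p0 * (\sum_(o <- l) o.1 * g o.2) +
                         p1 * (\sum_(o <- r) o.1 * g o.2)).
Proof.
rewrite big_cons big_cat !big_map !mulr_sumr /=; congr (_ + (_ + _));
  by apply: eq_bigr => o _; rewrite mulrA.
Qed.

Lemma expect_NodeX (p0 p1 : X -> R) l r x y g :
  expect (NodeX p0 p1 l r) x y g =
  (1 - p0 x - p1 x) * g 0 + (p0 x * expect l x y g + p1 x * expect r x y g).
Proof. exact: expect_branch. Qed.

Lemma expect_NodeY (q0 q1 : Y -> R) l r x y g :
  expect (NodeY q0 q1 l r) x y g =
  (1 - q0 y - q1 y) * g 0 + (q0 y * expect l x y g + q1 y * expect r x y g).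
Proof. exact: expect_branch. Qed.

Lemma expect_LeafX (L : X -> R) x y g :
  expect (LeafX Y L) x y g = g (L x).
Proof. by rewrite /expect big_seq1 mul1r. Qed.

Lemma expect_LeafY (L : Y -> R) x y g :
  expect (LeafY X L) x y g = g (L y).
Proof. by rewrite /expect big_seq1 mul1r. Qed.

Lemma expect_cst t x y (c : R) : expect t x y (fun=> c) = c.
Proof.
elim: t => [L|L|p0 p1 l IHl r IHr|q0 q1 l IHl r IHr];
  by rewrite ?expect_LeafX ?expect_LeafY ?expect_NodeX ?expect_NodeY ?IHl ?IHr //;
  ring.
Qed.

Lemma expectZ t x y (c : R) g : expect t x y (fun v => g v * c) = expect t x y g * c.
Proof. by rewrite /expect mulr_suml; apply: eq_bigr => o _; rewrite mulrA. Qed.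

(** Comparing [g] and [h] on nonnegative values is enough: leaves output nonnegative values, and
    stopping earlier gives [0]. *)
Lemma ler_expect t x y g h : protocol_wf t ->
  (forall v, 0 <= v -> g v <= h v) -> expect t x y g <= expect t x y h.
Proof.
move=> + gh; elim: t => [L|L|p0 p1 l IHl r IHr|q0 q1 l IHl r IHr] /=.
- by move=> L0; rewrite !expect_LeafX; apply: gh.
- by move=> L0; rewrite !expect_LeafY; apply: gh.
- case=> /(_ x) [p0_ge0 p1_ge0 p_le1] /IHl{}IHl /IHr{}IHr.
  rewrite !expect_NodeX !lerD ?ler_wpM2l // ?gh //; lra.
- case=> /(_ y) [p0_ge0 p1_ge0 p_le1] /IHl{}IHl /IHr{}IHr.
  rewrite !expect_NodeY !lerD ?ler_wpM2l // ?gh //; lra.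
Qed.

(** Stops at internal nodes are included, their value being [0]. *)
Definition zero_prob t x y := expect t x y (fun v => (v == 0)%:R).

Lemma zero_prob_ge0 t x y : protocol_wf t -> 0 <= zero_prob t x y.
Proof.
by move=> wf; rewrite -[leLHS](expect_cst t x y); apply: ler_expect.
Qed.

(** A nonnegative variable of mean 0 vanishes almost surely; in the induction, each child has
    transition probability 0 or expectation 0. *)
Lemma zero_prob_eq1 t x y : protocol_wf t -> expect t x y id = 0 ->
  zero_prob t x y = 1.
Proof.
move=> + ; elim: t => [L|L|p0 p1 l IHl r IHr|q0 q1 l IHl r IHr] /=.
- by rewrite /zero_prob !expect_LeafX => _ ->; rewrite eqxx.
- by rewrite /zero_prob !expect_LeafY => _ ->; rewrite eqxx.
- case=> /(_ x) [p0_ge0 p1_ge0 p_le1] wl wr.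
  rewrite /zero_prob !expect_NodeX mulr0 add0r eqxx mulr1 -!/(zero_prob _ _ _).
  have El : 0 <= expect l x y id.
    by rewrite -[leLHS](expect_cst l x y); apply: ler_expect.
  have Er : 0 <= expect r x y id.
    by rewrite -[leLHS](expect_cst r x y); apply: ler_expect.
  move/eqP; rewrite paddr_eq0 ?mulr_ge0 // !mulf_eq0.
  case/andP=> /orP[/eqP->|/eqP/(IHl wl)->] /orP[/eqP->|/eqP/(IHr wr)->]; ring.
- case=> /(_ y) [p0_ge0 p1_ge0 p_le1] wl wr.
  rewrite /zero_prob !expect_NodeY mulr0 add0r eqxx mulr1 -!/(zero_prob _ _ _).
  have El : 0 <= expect l x y id.
    by rewrite -[leLHS](expect_cst l x y); apply: ler_expect.
  have Er : 0 <= expect r x y id.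
    by rewrite -[leLHS](expect_cst r x y); apply: ler_expect.
  move/eqP; rewrite paddr_eq0 ?mulr_ge0 // !mulf_eq0.
  case/andP=> /orP[/eqP->|/eqP/(IHl wl)->] /orP[/eqP->|/eqP/(IHr wr)->]; ring.
Qed.

(* Chebyshev: the value [0] is at distance 1 from the mean of [xi / S]. *)
Lemma zero_prob_le_var t x y (S : R) : protocol_wf t ->
  expect t x y id = S -> S != 0 -> zero_prob t x y <= var t x y (fun v => v / S).
Proof.
move=> wf ES S0; rewrite /var expectZ ES divff //; apply: ler_expect => // v _.
case: eqP => [->|_]; last exact: sqr_ge0.
by rewrite mul0r sub0r sqrrN expr1n.
Qed.

(* One term for each node of the tree. *)
Lemma rank_one_sum_zero_prob t : protocol_wf t ->
  rank_one_sum (2 ^ (complexity t).+1).-1 (zero_prob t).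
Proof.
have b01 (b : bool) : 0 <= (b%:R : R) <= 1 by case: b; rewrite ?lexx ler01.
have one01 : 0 <= (1 : R) <= 1 := b01 true.
have card_node l r : (1 + ((2 ^ (@complexity R X Y l).+1).-1 + (2 ^ (@complexity R X Y r).+1).-1) <=
    (2 ^ (maxn (complexity l) (complexity r)).+2).-1)%N.
  have := leq_pexp2l (isT : 0 < 2)%N (leq_maxl (complexity l) (complexity r)).
  have := leq_pexp2l (isT : 0 < 2)%N (leq_maxr (complexity l) (complexity r)).
  have := expn_gt0 2 (complexity l); have := expn_gt0 2 (complexity r).
  rewrite !expnS; lia.
elim: t => [L|L|p0 p1 l IHl r IHr|q0 q1 l IHl r IHr] /=.
- move=> _; apply: (eq_rank_one_sum (M := fun x _ => (L x == 0)%:R * 1)).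
    by move=> x y; rewrite /zero_prob expect_LeafX mulr1.
  exact: rank_one_sum1.
- move=> _; apply: (eq_rank_one_sum (M := fun _ y => 1 * (L y == 0)%:R)).
    by move=> x y; rewrite /zero_prob expect_LeafY mul1r.
  exact: rank_one_sum1.
- case=> p01 /IHl{}IHl /IHr{}IHr.
  apply: (rank_one_sum_leq (card_node l r)).
  (* Stopping at the root gives one term; scaling the rows of a child's matrix does not increase its
     number of terms. The factors 1 exhibit the rank-one form. *)
  apply: (eq_rank_one_sum (M := fun x y => (1 - p0 x - p1 x) * 1 +
     ((p0 x * 1) * zero_prob l x y + (p1 x * 1) * zero_prob r x y))).
    by move=> x y; rewrite /zero_prob expect_NodeX eqxx !mulr1.
  apply: rank_one_sumD; last (apply: rank_one_sumD; rewrite -[_.-1]mul1n;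
    apply: rank_one_sumM => //); apply: rank_one_sum1 => // x;
    by have [? ? ?] := p01 x; apply/andP; split; lra.
- case=> p01 /IHl{}IHl /IHr{}IHr.
  apply: (rank_one_sum_leq (card_node l r)).
  apply: (eq_rank_one_sum (M := fun x y => 1 * (1 - q0 y - q1 y) +
     ((1 * q0 y) * zero_prob l x y + (1 * q1 y) * zero_prob r x y))).
    by move=> x y; rewrite /zero_prob expect_NodeY eqxx !mul1r mulr1.
  apply: rank_one_sumD; last (apply: rank_one_sumD; rewrite -[_.-1]mul1n;
    apply: rank_one_sumM => //); apply: rank_one_sum1 => // y;
    by have [? ? ?] := p01 y; apply/andP; split; lra.
Qed.

End Protocols.

Lemma zero_prob_le_normalized_variance (R : realType) (X Y : finType)
    (t : protocol R X Y) (S : X -> Y -> R) x y :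
  protocol_wf t -> computes_in_expectation t S -> S x y != 0 ->
  zero_prob t x y <= normalized_variance t S.
Proof.
move=> wf tS Sxy; apply: (le_trans (zero_prob_le_var wf (tS x y) Sxy)).
by rewrite /normalized_variance (bigmaxD1 (x, y)) // le_max lexx.
Qed.

(** * Double stars *)

Section DoubleStar.
Variable k : nat.
Implicit Types (A B : {set 'I_k}) (u v : 'I_k.+2).

Definition hub0 : 'I_k.+2 := ord0.
Definition hub1 : 'I_k.+2 := lift ord0 ord0.
Definition leaf (i : 'I_k) : 'I_k.+2 := lift ord0 (lift ord0 i).

(** The tree is rooted at [hub0], where the value is a dummy that [double_star] excludes. *)
Definition parent B v : 'I_k.+2 :=
  if [exists i in B, v == leaf i] then hub1 else hub0.

Variant vertex_spec : 'I_k.+2 -> Prop :=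
| VertexHub0 : vertex_spec hub0
| VertexHub1 : vertex_spec hub1
| VertexLeaf i : vertex_spec (leaf i).

Lemma vertexP v : vertex_spec v.
Proof.
case: (unliftP ord0 v) => [w|] ->; last by constructor.
by case: (unliftP ord0 w) => [i|] ->; constructor.
Qed.

Lemma leaf_inj : injective leaf.
Proof. by move=> i j /lift_inj /lift_inj. Qed.

Lemma leaf_neq_hub0 i : (leaf i == hub0) = false.
Proof. by []. Qed.

Lemma leaf_neq_hub1 i : (leaf i == hub1) = false.
Proof. by []. Qed.

Lemma parent_leaf B i : parent B (leaf i) = if i \in B then hub1 else hub0.
Proof.
rewrite /parent; case: existsP => [[j /andP[jB /eqP/leaf_inj->]]|]; first by rewrite jB.
by case: ifP => // iB []; exists i; rewrite iB eqxx.
Qed.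

Lemma parent_hub1 B : parent B hub1 = hub0.
Proof. by rewrite /parent; case: existsP => // -[j /andP[]]. Qed.

Lemma parent_neq_leaf B v i : (leaf i == parent B v) = false.
Proof. by rewrite /parent; case: ifP. Qed.

Lemma parent_neq B v : v != hub0 -> (v == parent B v) = false.
Proof.
case: (vertexP v) => [|_|i _]; rewrite ?eqxx // ?parent_neq_leaf //.
by rewrite parent_hub1.
Qed.

Definition double_star B : {set edge k.+2} :=
  [set e | [exists v, (v != hub0) && (val e == [set v; parent B v])]]%SET.

Lemma adj_double_starP B u v :
  reflect (u != hub0 /\ v = parent B u \/ v != hub0 /\ u = parent B v)
          (adj (double_star B) u v).
Proof.
apply: (iffP existsP) => [[e /andP[]]|].
  rewrite inE => /existsP[w /andP[w0 /eqP->]] /eqP E; have wp := parent_neq B w0.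
  have: u \in [set w; parent B w]%SET by rewrite E !inE eqxx.
  have: v \in [set w; parent B w]%SET by rewrite E !inE eqxx orbT.
  have: w \in [set u; v]%SET by rewrite -E !inE eqxx.
  have: parent B w \in [set u; v]%SET by rewrite -E !inE eqxx orbT.
  rewrite !inE => + + /orP[]/eqP vE /orP[]/eqP uE; rewrite {}uE {}vE.
  - by rewrite eq_sym wp.
  - by right.
  - by left.
  - by rewrite wp.
wlog: u v / u != hub0 /\ v = parent B u.
  move=> IH [H|H]; first by apply: IH; [|left].
  have [|e /andP[eT /eqP eE]] := IH v u H; first by left.
  by exists e; rewrite eT eE finset.setUC eqxx.
case=> u0 -> _; have uv : #|[set u; parent B u]%SET| == 2%N.
  by rewrite cards2 parent_neq.
exists (exist (fun e : {set 'I_k.+2} => #|e| == 2%N) _ uv); rewrite /= eqxx andbT inE.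
by apply/existsP; exists u; rewrite u0 /=.
Qed.

Lemma adj_double_star_leaf B i v :
  adj (double_star B) (leaf i) v \/ adj (double_star B) v (leaf i) ->
  v = parent B (leaf i).
Proof.
by case=> /adj_double_starP[] [_ E] //; move/eqP: E; rewrite parent_neq_leaf.
Qed.

Lemma adj_sym n (T : {set edge n}) : symmetric (adj T).
Proof.
by move=> u v; apply: eq_existsb => e; rewrite (finset.setUC [set u]%SET).
Qed.

Lemma double_star_tree B : is_spanning_tree (double_star B).
Proof.
split=> [u v|c /andP[cyc uc]].
  have sym := sym_connect_sym (adj_sym (double_star B)).
  have step w : w != hub0 -> connect (adj (double_star B)) w (parent B w).
    by move=> w0; apply/connect1/adj_double_starP; left.
  have c1 : connect (adj (double_star B)) hub1 hub0.
    by have := step hub1 isT; rewrite parent_hub1.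
  have to0 w : connect (adj (double_star B)) w hub0.
    case: (vertexP w) => // i; apply: connect_trans (step _ _) _ => //.
    by rewrite parent_leaf; case: ifP.
  by apply: connect_trans (to0 u) _; rewrite sym.
rewrite leqNgt; apply/negP => c3.
(* A cycle with at least three vertices cannot consist of hubs only. A leaf on it would have two
   distinct neighbours, both equal to its parent. *)
have [i ic|noleaf] := pickP [pred i | leaf i \in c]; last first.
  suff /(uniq_leq_size uc) : {subset c <= [:: hub0; hub1]} by rewrite leqNgt c3.
  by move=> v vc; case: (vertexP v) vc => [||i]; rewrite ?inE ?eqxx ?orbT // => ic;
    have := noleaf i; rewrite /= ic.
have [j c' rE] := rot_to ic.
move: cyc uc c3; rewrite -(rot_cycle j) -(rot_uniq j) -(size_rot j c) {}rE.
case: c' => [|y [|z c']] //=; rewrite rcons_path /=.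
case/andP=> iy /andP[_ /andP[_ ei]].
have -> : y = parent B (leaf i) by apply: adj_double_star_leaf; left.
rewrite -(@adj_double_star_leaf B i (last z c')); last by right.
by rewrite mem_last !andbF.
Qed.

Definition star_cut_set A : {set 'I_k.+2} := (hub0 |: [set leaf i | i in A])%SET.

Lemma mem_star_cut_set A v :
  (v \in star_cut_set A) = (v == hub0) || [exists i in A, v == leaf i].
Proof.
rewrite !inE; congr (_ || _); apply/imsetP/existsP => [[i iA ->]|[i /andP[iA /eqP->]]].
  by exists i; rewrite iA eqxx.
by exists i.
Qed.

Lemma hub1_notin_cut A : (hub1 \in star_cut_set A) = false.
Proof.
by rewrite mem_star_cut_set /=; apply/existsP => -[i /andP[_]]; rewrite eq_sym leaf_neq_hub1.
Qed.

Lemma leaf_in_cut A i : (leaf i \in star_cut_set A) = (i \in A).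
Proof.
rewrite mem_star_cut_set leaf_neq_hub0 /=; apply/existsP/idP => [[j]|iA].
  by case/andP=> jA /eqP/leaf_inj ->.
by exists i; rewrite iA eqxx.
Qed.

Lemma star_cut_proper A :
  (star_cut_set A != finset.set0) && (star_cut_set A != [set: 'I_k.+2]%SET).
Proof.
apply/andP; split; first by apply/set0Pn; exists hub0; rewrite mem_star_cut_set eqxx.
by apply/eqP => /setP/(_ hub1); rewrite hub1_notin_cut inE.
Qed.

Definition star_cut A : slack_row k.+2 :=
  inl (exist (fun U : {set 'I_k.+2} =>
                (U != finset.set0) && (U != [set: 'I_k.+2]%SET))
             (star_cut_set A) (star_cut_proper A)).

Definition star_col B : slack_col k.+2 :=
  exist (fun T : {set edge k.+2} => `[< is_spanning_tree T >]) (double_star B)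
    (asboolT (double_star_tree B)).

(** The edges inside the cut are the spokes from [hub0] to leaves of [A] outside [B]: leaves in [B]
    hang from [hub1], which is not in the cut. *)
Lemma card_double_star_cut A B :
  #|[set e in double_star B | val e \subset star_cut_set A]%SET| = #|(A :\: B)%SET|.
Proof.
pose spoke (i : 'I_k) := [set leaf i; hub0]%SET.
have spoke_inj : injective spoke.
  move=> i j /setP/(_ (leaf i)); rewrite !inE eqxx leaf_neq_hub0 !orbF.
  by move/esym/eqP/leaf_inj.
rewrite -(card_imset _ val_inj) -(card_imset (A :\: B)%SET spoke_inj); congr #|pred_of_set _|.
apply/setP => s; apply/imsetP/imsetP => [[e]|[i]].
  rewrite !inE => /andP[/existsP[v /andP[v0 /eqP eE]] eU] ->.
  move: eU; rewrite eE => /fintype.subsetP eU.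
  have := eU v (set21 _ _); have := eU (parent B v) (set22 _ _).
  case: (vertexP v) v0 {eU eE} => // [_ _|i _]; first by rewrite hub1_notin_cut.
  rewrite leaf_in_cut parent_leaf; case: ifP => iB; first by rewrite hub1_notin_cut.
  by move=> _ iA; exists i; rewrite // !inE iB iA.
rewrite !inE => /andP[iB iA] ->.
have c2 : #|spoke i| == 2%N by rewrite cards2.
exists (exist (fun e : {set 'I_k.+2} => #|e| == 2%N) _ c2) => //; rewrite !inE; apply/andP; split.
  by apply/existsP; exists (leaf i); rewrite /= parent_leaf (negPf iB) eqxx.
apply/fintype.subsetP => v /set2P[]->.
  by rewrite leaf_in_cut.
by rewrite mem_star_cut_set eqxx.
Qed.

Lemma slack_double_star (R : realType) A B :
  slack R (star_cut A) (star_col B) = #|(A :&: B)%SET|%:R.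
Proof.
rewrite /slack /star_cut /star_col /= card_double_star_cut cardsU1 card_imset; last exact: leaf_inj.
have -> : hub0 \notin [set leaf i | i in A]%SET by apply/imsetP => -[].
rewrite -(cardsID B A) /= !natrD; ring.
Qed.

End DoubleStar.

(** * Lower bound *)

(** A tree of height 0 is a single leaf, whose output depends on only one of the two inputs. *)
Lemma complexity_gt0 (R : realType) (X Y : Type) (t : protocol R X Y)
    (S : X -> Y -> R) x x' y y' :
  computes_in_expectation t S -> S x y != S x' y -> S x y != S x y' ->
  (0 < complexity t)%N.
Proof.
case: t => // L tS.
  have SE u v : S u v = L u by rewrite -tS expect_LeafX.
  by rewrite !SE eqxx.
have SE u v : S u v = L v by rewrite -tS expect_LeafY.
by rewrite !SE eqxx.
Qed.

Lemma spanning_tree_complexity_gt0 (R : realType) k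
    (t : protocol R (slack_row k.+2) (slack_col k.+2)) :
  (0 < k)%N -> computes_in_expectation t (@slack R k.+2) ->
  (0 < complexity t)%N.
Proof.
case: k t => // k t _ tS; pose A : {set 'I_k.+1} := [set ord0]%SET.
apply: (complexity_gt0 (x := star_cut A) (x' := star_cut finset.set0)
  (y := star_col A) (y' := star_col finset.set0)) tS _ _;
by rewrite !slack_double_star finset.setIid ?finset.set0I ?finset.setI0 cards1 cards0 oner_eq0.
Qed.

(** With 111 in the hypothesis, Bernoulli's inequality gives [(1 + (1 - s2)) ^+ m >= 112], which
    brings [s2 ^+ m] below the threshold 1/112 for intersecting pairs. *)
Lemma spanning_tree_protocol_bound (R : realType) k m
    (t : protocol R (slack_row k.+2) (slack_col k.+2)) :
  (0 < k)%N -> protocol_wf t -> computes_in_expectation t (@slack R k.+2) ->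
  111 <= m%:R * (1 - normalized_variance t (@slack R k.+2)) ->
  1 <= 144 * (((2 ^ (complexity t).+1) ^ m)%:R * decay R ^+ k).
Proof.
move=> k_gt0 wf tS; set s2 := normalized_variance _ _ => ms2.
have s2_ge0 : 0 <= s2 by apply: bigmax_ge_id.
have p_gt0 : 0 < 1 - s2.
  rewrite ltNge; apply/negP => p_le0.
  have := mulr_ge0_le0 (ler0n R m) p_le0; lra.
have [I [a [b [IN a01 b01 ZE]]]] := rank_one_sumX m (rank_one_sum_zero_prob wf).
have Zslack (A B : {set 'I_k}) : \sum_v a v (star_cut A) * b v (star_col B) =
    zero_prob t (star_cut A) (star_col B) ^+ m by rewrite ZE.
have := @disjointness_rank_lower_bound R 'I_k I (fun v A => a v (star_cut A))
  (fun v B => b v (star_col B)).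
rewrite card_ord => /(_ k_gt0 (fun v A => a01 v _) (fun v B => b01 v _)) bound.
apply: (@le_trans _ _ (144 * (#|I|%:R * decay R ^+ k))); last first.
  apply: ler_wpM2l => //; apply: ler_wpM2r.
    by rewrite exprn_ge0 // ltW ?decay_gt0.
  rewrite ler_nat; apply: leq_trans IN _.
  by case: (m) => [|m']; rewrite ?expn0 // leq_exp2r // leq_pred.
apply: bound => A B AB; rewrite Zslack.
  rewrite zero_prob_eq1 ?expr1n // tS slack_double_star.
  by move: AB; rewrite -setI_eq0 => /eqP->; rewrite cards0.
have Sn0 : slack R (star_cut A) (star_col B) != 0.
  by rewrite slack_double_star pnatr_eq0 cards_eq0 setI_eq0.
apply: (@le_trans _ _ (s2 ^+ m)).
  apply: lerXn2r; rewrite ?nnegrE ?zero_prob_ge0 //.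
  exact: zero_prob_le_normalized_variance.
(* [s2 <= 1 / (2 - s2)] turns Bernoulli's inequality into an upper bound. *)
have s2inv : s2 <= (1 + (1 - s2))^-1.
  by rewrite -[_^-1]mul1r ler_pdivlMr; [nra | lra].
apply: (@le_trans _ _ ((1 + (1 - s2)) ^+ m)^-1).
  by rewrite -exprVn; apply: lerXn2r => //; rewrite nnegrE invr_ge0; lra.
have pN1 : -1 <= 1 - s2 by lra.
have := bernoulli_ler m pN1; move: (_ ^+ m) => u Hu.
by rewrite lef_pV2 ?posrE //; lra.
Qed.

Local Open Scope classical_set_scope.

Theorem mainTheorem5 (R : realType) :
  exists2 c : R, 0 < c &
  exists N : nat, forall n : nat, (N <= n)%N ->
  forall (d r : nat) (Q : set 'cV[R]_d)
         (f : {linear 'cV[R]_d -> edge_space R n}),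
    is_extension Q f (@spanning_tree_polytope R n) -> has_size Q r ->
  forall t : protocol R (slack_row n) (slack_col n),
    protocol_wf t ->
    computes_in_expectation t (@slack R n) ->
    complexity t = up_log 2 r ->
    2 `^ (c * (n%:R * (1 - normalized_variance t (@slack R n)))) <= r%:R.
Proof.
pose kappa : R := - ln (decay R).
have kappa_gt0 : 0 < kappa.
  by rewrite oppr_gt0 ln_lt0 // decay_gt0 decay_lt1.
have ln2_gt0 : 0 < ln 2 :> R by rewrite ln_gt0 // ltr1n.
(* The factor 22 is 2 * 11, with 2 from [k.+2 <= 2 * k] and 11 from [size_le]; 112 bounds
   [m%:R * p]. *)
pose K : R := 22%:R * 112%:R.
have K_gt0 : 0 < K by rewrite mulr_gt0 // ltr0n.
exists (kappa / (K * ln 2)); first exact: divr_gt0 kappa_gt0 (mulr_gt0 K_gt0 ln2_gt0).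
(* Here [n] is [k.+2], and [n >= 4] gives [k.+2 <= 2 * k]. *)
exists 4%N => -[|[|k]] // k2 d r Q f _ _ t wf tS ct.
have k_gt0 : (0 < k)%N := ltnW (k2 : (1 < k)%N).
have := spanning_tree_complexity_gt0 k_gt0 tS; rewrite ct => ur_gt0.
have r_gt1 : (1 < r)%N.
  by rewrite ltnNge; apply/negP; case: r ur_gt0 {ct} => [|[]].
have r_gt0 : 0 < r%:R :> R by rewrite ltr0n ltnW.
set p := 1 - normalized_variance _ _.
have p_le1 : p <= 1.
  by rewrite lerBlDr lerDl; apply: bigmax_ge_id.
(* If [p <= 0], the exponent is nonpositive and [r >= 1] suffices. *)
have [p_le0|p_gt0] := leP p 0.
  apply: (@le_trans _ _ 1); last by rewrite ler1n ltnW.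
  rewrite -[leRHS](powRr0 2) ler_powR ?ler1n // pmulr_rle0; last first.
    exact: divr_gt0 kappa_gt0 (mulr_gt0 K_gt0 ln2_gt0).
  by rewrite pmulr_rle0 ?ltr0n.
(* Just large enough for [m%:R * p >= 111]; since [p <= 1], rounding up costs at most 1 in this
   product. *)
pose m := (Num.truncn (111 / p)).+1.
have /andP[mlo mhi] : m%:R <= 111 / p + 1 < m%:R + 1.
  have /truncn_itv/andP[lo hi] : 0 <= 111 / p by rewrite divr_ge0 // ltW.
  by rewrite /m -natr1 lerD2r lo ltrD2r natr1.
have mp_ge : 111 <= m%:R * p by rewrite -ler_pdivrMr // ltW // -(ltrD2r 1).
have mp_le : m%:R * p <= 112.
  have := ler_wpM2r (ltW p_gt0) mlo; rewrite mulrDl mulfVK ?gt_eqF // mul1r.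
  lra.
(* Use [144 <= 2 ^ 8 <= r ^ 8]. With [u = up_log 2 r], positive here, [2 ^ u.-1 < r], so
   [2 ^ u.+1 <= r ^ 3]. *)
have size_le : (144 * (2 ^ (complexity t).+1) ^ m <= r ^ (11 * m))%N.
  have -> : (11 * m = 8 * m + 3 * m)%N by rewrite -mulnDl.
  rewrite expnD !expnM leq_mul //.
    apply: (@leq_trans (2 ^ 8)) => //; apply: (@leq_trans (r ^ 8)).
      by rewrite leq_exp2r.
    by rewrite -{1}[(r ^ 8)%N]expn1 leq_exp2l // (@leq_trans (2 ^ 8)) // leq_exp2r.
  rewrite leq_exp2r // ct; have := up_log_gtn (isT : 1 < 2)%N r_gt1.
  case: (up_log 2 r) ur_gt0 => // u _; rewrite !expnS expn0 muln1 /= => ur.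
  exact: leq_mul r_gt1 (leq_mul r_gt1 (ltnW ur)).
have ln_bound : kappa * k%:R <= 11 * m%:R * ln r%:R.
  have dk_gt0 : 0 < decay R ^+ k by rewrite exprn_gt0 ?decay_gt0.
  have : 1 <= r%:R ^+ (11 * m) * decay R ^+ k.
    apply: le_trans (spanning_tree_protocol_bound k_gt0 wf tS mp_ge) _.
    rewrite mulrA; apply: (ler_wpM2r (ltW dk_gt0)); rewrite -natrM -natrX.
    by rewrite ler_nat.
  move=> /ln_ge0; rewrite lnM ?posrE ?exprn_gt0 ?decay_gt0 //.
  rewrite (lnXn _ r_gt0) (lnXn _ (decay_gt0 R)).
  rewrite -[ln r%:R *+ _]mulr_natl -[ln (decay R) *+ _]mulr_natl natrM /kappa.
  by move: (ln _) (ln _) m%:R k%:R; clear=> u v x y; lra.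
have lnr_gt0 : 0 < ln r%:R :> R by rewrite ln_gt0 // ltr1n.
have key : kappa * (k.+2%:R * p) <= K * ln r%:R.
  have kk : k.+2%:R <= 2 * k%:R :> R by rewrite -natrM ler_nat -addn2 mul2n -addnn leq_add2l.
  have h1 : kappa * k%:R * p <= 11 * m%:R * ln r%:R * p by rewrite ler_wpM2r // ltW.
  have h2 : m%:R * p * ln r%:R <= 112 * ln r%:R by rewrite ler_wpM2r // ltW.
  have h3 : kappa * (k.+2%:R * p) <= kappa * (2 * k%:R * p).
    by apply: (ler_wpM2l (ltW kappa_gt0)); apply: (ler_wpM2r (ltW p_gt0)).
  rewrite /K; move: (ln _) h1 h2 h3 {mp_ge mp_le mlo mhi} => L.
  by move: m%:R (p) k%:R k.+2%:R (kappa); clear=> *; lra.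
rewrite /powR pnatr_eq0 /= -[leRHS]lnK ?posrE // ler_expR.
have -> : kappa / (K * ln 2) * (k.+2%:R * p) * ln 2 = kappa * (k.+2%:R * p) / K.
  move: (kappa) (p) (K) (ln 2) (k.+2%:R) K_gt0 ln2_gt0; clear=> a b x y n x0 y0.
  by field; rewrite !gt_eqF.
by rewrite ler_pdivrMr // [leRHS]mulrC.
Qed.
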